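(* Let $\mathrm{D}^{Q}$ be a function assigning to every pair $(\rho,\sigma)$ of density operators on a common finite-dimensional Hilbert space a value $\mathrm{D}^{Q}(\rho\|\sigma)\in\mathbb{R}\cup\{+\infty\}$. Suppose: (M) for every CPTP map $\Lambda$ (between operators on finite-dimensional Hilbert spaces) and all $\rho,\sigma$ in its domain, $\mathrm{D}^{Q}(\rho\|\sigma)\ge \mathrm{D}^{Q}(\Lambda(\rho)\|\Lambda(\sigma))$; (N) for all probability distributions $p,q$ on a finite set, $\mathrm{D}^{Q}(p\|q)=\mathrm{D}(p\|q)=\sum_x p(x)(\ln p(x)-\ln q(x))$. Then for all density operators $\rho,\sigma$ on a common finite-dimensional Hilbert space, $$\max_{M}\mathrm{D}(M(\rho)\|M(\sigma))\le \mathrm{D}^{Q}(\rho\|\sigma)\le \mathrm{D}^{R}(\rho\|\sigma),$$ where the maximum is over all measurements $M$ and $\mathrm{D}^{R}(\rho\|\sigma)=\mathrm{tr}\,\rho\ln\left(\sqrt{\rho}\,\sigma^{-1}\sqrt{\rho}\right)$.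
   Context: A probability distribution $p$ on a finite set $\mathcal{X}$ is identified with the diagonal density operator on $\mathbb{C}^{\mathcal{X}}$ with entries $p(x)$. CPTP means completely positive and trace preserving. A measurement $M$ is a POVM with finitely many outcomes, and $M(\rho)$ denotes the probability distribution of the outcome when $M$ is applied to $\rho$. In $\mathrm{D}^{R}$, $\sigma^{-1}$ is the generalized (Moore–Penrose) inverse and the logarithm is taken on $\mathrm{supp}\,\rho$; the convention is $\mathrm{D}^{R}(\rho\|\sigma)=+\infty$ if $\mathrm{supp}\,\rho\not\subset\mathrm{supp}\,\sigma$. Likewise $\mathrm{D}(p\|q)=+\infty$ if $\mathrm{supp}\,p\not\subset\mathrm{supp}\,q$, and $0\ln 0=0$. *)

(* Defs.v *)
From HB Require Import structures.
From mathcomp Require Import all_boot all_order all_algebra.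
From mathcomp Require Import spectral sesquilinear complex.
From mathcomp Require Import ring.
From mathcomp Require Import boolp classical_sets reals constructive_ereal exp.

Set Implicit Arguments.
Unset Strict Implicit.
Unset Printing Implicit Defensive.

Import Order.TTheory GRing.Theory Num.Theory.
Local Open Scope ring_scope.
Local Open Scope sesquilinear_scope.

(* The Hilbert space C^n is the space 'rV[R[i]]_n of row vectors, on which
   matrices act from the right: A maps u to u *m A. *)

(* The next three lemmas are stated over an abstract field: rewriting with
   matrices over R[i] is slow. *)
Lemma mul_conj_diag (F : numClosedFieldType) n (P : 'M[F]_n) (d e : 'rV[F]_n) :
  P \is unitarymx ->
  (invmx P *m diag_mx d *m P) *m (invmx P *m diag_mx e *m P) =
  invmx P *m diag_mx (\row_i (d 0 i * e 0 i)) *m P.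
Proof.
move=> /unitarymx_unit Pu; rewrite !mulmxA mulmxK//.
by rewrite -(mulmxA _ (diag_mx d)) mulmx_diag.
Qed.

Lemma hermsym_conj_diag (F : numClosedFieldType) n (P : 'M[F]_n) (d : 'rV[F]_n) :
  P \is unitarymx -> (forall i, d 0 i \is Num.real) ->
  invmx P *m diag_mx d *m P \is hermsymmx.
Proof.
move=> Pu dreal; apply/is_hermitianmxP; rewrite expr0 scale1r invmx_unitary//.
rewrite !trmx_mul !map_mxM /= tr_diag_mx map_diag_mx map_trmx trmxK.
rewrite -map_mx_comp mulmxA [X in _ = _ *m X](_ : _ = P); last first.
  by apply/matrixP => i j; rewrite mxE /= conjCK.
rewrite (_ : map_mx _ d = d) ?map_trmx//.
by apply/rowP => i; rewrite mxE; exact/CrealP.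
Qed.

Lemma spectral_diag_form (F : numClosedFieldType) n (A : 'M[F]_n) i :
  let u := row i (spectralmx A) in
  A \is normalmx -> spectral_diag A 0 i = (u *m A *m u ^t*) 0 0.
Proof.
move=> u An; rewrite {2}(orthomx_spectralP An) /u rowE.
rewrite trmx_mul map_mxM trmx_delta map_delta_mx.
rewrite -(invmx_unitary (spectral_unitarymx A)) !mulmxA !mulmxK ?spectral_unit//.
by rewrite -rowE -colE !mxE eqxx.
Qed.

Section Operators.
Variable R : realType.
Local Notation C := R[i].

(* z >= 0 in C means that z is real and nonnegative. *)
Definition psdmx n (A : 'M[C]_n) : Prop :=
  forall u : 'rV[C]_n, 0 <= (u *m A *m u ^t*) 0 0.

Definition density n (rho : 'M[C]_n) : Prop := psdmx rho /\ \tr rho = 1.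

(* Functional calculus for a Hermitian matrix A, whose spectral_diag is real
   (hermitian_spectral_diag_real). *)
Definition mxfun n (f : R -> R) (A : 'M[C]_n) : 'M[C]_n :=
  invmx (spectralmx A)
  *m diag_mx (\row_i (f (complex.Re (spectral_diag A 0 i)))%:C%C)
  *m spectralmx A.

Definition sqrtmx n (A : 'M[C]_n) : 'M[C]_n := mxfun Num.sqrt A.

(* Moore-Penrose inverse of a Hermitian matrix: 0^-1 = 0, so the zero
   eigenvalues stay zero; see ginvmx_penrose below. *)
Definition ginvmx n (A : 'M[C]_n) : 'M[C]_n := mxfun GRing.inv A.

(* Logarithm of a positive semidefinite matrix, taken on its support:
   ln 0 = 0 in the library, so that logmx A vanishes on the kernel of A. *)
Definition logmx n (A : 'M[C]_n) : 'M[C]_n := mxfun (@ln R) A.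

(* A matrix of size \sum_(i < k) n is an operator on C^k (x) C^n, with blocks
   B i j; id (x) Lambda applies Lambda to each block. *)
Definition completely_positive n m (Lambda : 'M[C]_n -> 'M[C]_m) : Prop :=
  forall (k : nat) (B : 'I_k -> 'I_k -> 'M[C]_n),
    psdmx (\mxblock_(i < k, j < k) B i j) ->
    psdmx (\mxblock_(i < k, j < k) Lambda (B i j)).

Definition trace_preserving n m (Lambda : 'M[C]_n -> 'M[C]_m) : Prop :=
  forall A, \tr (Lambda A) = \tr A.

Definition cptp n m (Lambda : {linear 'M[C]_n -> 'M[C]_m}) : Prop :=
  completely_positive Lambda /\ trace_preserving Lambda.

Definition povm n k (M : 'I_k -> 'M[C]_n) : Prop :=
  (forall x, psdmx (M x)) /\ \sum_x M x = 1%:M.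

(* The trace is real when M x and rho are positive semidefinite. *)
Definition outcome n k (M : 'I_k -> 'M[C]_n) (rho : 'M[C]_n) : 'I_k -> R :=
  fun x => complex.Re (\tr (rho *m M x)).

Definition distribution k (p : 'I_k -> R) : Prop :=
  (forall x, 0 <= p x) /\ \sum_x p x = 1.

Definition diag_op k (p : 'I_k -> R) : 'M[C]_k := diag_mx (\row_x (p x)%:C%C).

(* When p x = 0 the term is 0, whatever the values of the logarithms. *)
Definition relent k (p q : 'I_k -> R) : \bar R :=
  if [forall x, (p x != 0) ==> (q x != 0)]
  then (\sum_x p x * (ln (p x) - ln (q x)))%:E else +oo%E.

Definition measured_relents n (rho sigma : 'M[C]_n) : set (\bar R) :=
  [set d | exists (k : nat) (M : 'I_k -> 'M[C]_n),
     povm M /\ d = relent (outcome M rho) (outcome M sigma)].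

Definition is_max (A : set (\bar R)) (d : \bar R) : Prop := A d /\ ubound A d.

(* The support of a Hermitian matrix is its range, i.e. its row space. *)
Definition relentR n (rho sigma : 'M[C]_n) : \bar R :=
  if (rho <= sigma)%MS
  then (complex.Re (\tr (rho *m
          logmx (sqrtmx rho *m ginvmx sigma *m sqrtmx rho))))%:E
  else +oo%E.

Lemma psdmx_hermsym n (A : 'M[C]_n) : psdmx A -> A \is hermsymmx.
Proof.
move=> Apos; apply/is_hermitianmxP; rewrite expr0 scale1r.
pose q (u v : 'rV[C]_n) := (u *m A *m v ^t*) 0 0.
have qDl u u' v : q (u + u') v = q u v + q u' v.
  by rewrite /q !mulmxDl mxE.
have qDr u v v' : q u (v + v') = q u v + q u v'.
  by rewrite /q linearD /= map_mxD mulmxDr mxE.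
have qZl a u v : q (a *: u) v = a * q u v.
  by rewrite /q -!scalemxAl mxE.
have qZr a u v : q u (a *: v) = a^* * q u v.
  by rewrite /q linearZ /= map_mxZ -!scalemxAr mxE.
have qR u : (q u u)^* = q u u by apply: CrealP; exact: ger0_real (Apos u).
have qC u v : (q u v)^* = q v u.
  have := qR (u + v); rewrite !(qDl, qDr) !rmorphD /= !qR.
  have := qR (u + 'i *: v).
  rewrite !(qDl, qDr, qZl, qZr) !rmorphD /= !rmorphM /= !qR conjCi raddfN /= conjCi.
  set a := q u u; set b := q v v; set c := q u v; set d := q v u.
  move: (c^*) (d^*) => c' d' e1 e2.
  have {}e2 : c' + d' = c + d.
    apply: (addrI a); apply: (addIr b).
    by transitivity (a + c' + (d' + b)); [ring | rewrite e2; ring].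
  have {}e1 : c' - d' = d - c.
    apply: (mulfI (neq0Ci C)); apply: (addrI a); apply: (addIr b).
    have ii : - 'i * 'i = 1 :> C by rewrite mulNr -expr2 sqrCi opprK.
    move: e1; rewrite opprK !mulrA ii [_ * - 'i]mulrC ii !mul1r => e1.
    by transitivity (a + 'i * c' + (- 'i * d' + b)); [ring | rewrite e1; ring].
  have {}e : 2 * c' = 2 * d :> C.
    by transitivity (c' - d' + (c' + d')); [ring | rewrite e1 e2; ring].
  by apply: mulfI e; rewrite pnatr_eq0.
apply/matrixP => i j; rewrite !mxE.
have qE k l : q (delta_mx 0 k) (delta_mx 0 l) = A k l.
  by rewrite /q -rowE trmx_delta map_delta_mx -colE !mxE.
by rewrite -qE -[X in _ = _ X]qE qC.
Qed.

Lemma mxfun_id n (A : 'M[C]_n) : A \is hermsymmx -> mxfun id A = A.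
Proof.
move=> Ah; rewrite [RHS](orthomx_spectralP (hermitian_normalmx Ah)) /mxfun.
rewrite (_ : \row__ _ = spectral_diag A)//; apply/rowP => i; rewrite mxE.
have /mxOverP/(_ 0 i) := hermitian_spectral_diag_real Ah.
exact: RRe_real.
Qed.

Lemma mxfunM n (f g : R -> R) (A : 'M[C]_n) :
  mxfun f A *m mxfun g A = mxfun (fun x => f x * g x) A.
Proof.
apply: etrans (mul_conj_diag _ _ (spectral_unitarymx A)) _.
rewrite /mxfun [X in diag_mx X](_ : _ = \row_i (f (complex.Re (spectral_diag A 0 i))
    * g (complex.Re (spectral_diag A 0 i)))%:C%C)//.
by apply/rowP => i; rewrite !mxE rmorphM.
Qed.

Lemma mxfun_hermsym n (f : R -> R) (A : 'M[C]_n) : mxfun f A \is hermsymmx.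
Proof.
apply: hermsym_conj_diag; first exact: spectral_unitarymx.
by move=> i; rewrite mxE; apply/complex_realP; eexists.
Qed.

Lemma eq_mxfun n (f g : R -> R) (A : 'M[C]_n) : f =1 g -> mxfun f A = mxfun g A.
Proof. by move=> /funext ->. Qed.

Lemma sqrtmx_sqr n (A : 'M[C]_n) : psdmx A -> sqrtmx A *m sqrtmx A = A.
Proof.
move=> Apos; have Ah := psdmx_hermsym Apos.
have An := hermitian_normalmx Ah.
have d0 i : 0 <= spectral_diag A 0 i.
  by rewrite spectral_diag_form//; exact: Apos.
rewrite /sqrtmx mxfunM [RHS](orthomx_spectralP An) /mxfun.
rewrite (_ : \row__ _ = spectral_diag A)//; apply/rowP => i.
rewrite mxE -expr2 sqr_sqrtr; last by have := d0 i; rewrite lecE => /andP[].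
by apply: RRe_real; apply: ger0_real.
Qed.

Lemma ginvmx_penrose n (A : 'M[C]_n) : A \is hermsymmx ->
  [/\ A *m ginvmx A *m A = A, ginvmx A *m A *m ginvmx A = ginvmx A,
      A *m ginvmx A \is hermsymmx & ginvmx A *m A \is hermsymmx].
Proof.
move=> Ah; have AE := mxfun_id Ah.
have AG : A *m ginvmx A = mxfun (fun x => x * x^-1) A by rewrite -mxfunM AE.
have GA : ginvmx A *m A = mxfun (fun x => x^-1 * x) A by rewrite -mxfunM AE.
rewrite AG GA; split.
- rewrite -[X in _ *m X]AE mxfunM -[RHS]AE; apply: eq_mxfun => x.
  by have [->|x0] := eqVneq x 0; rewrite ?mulr0// mulfV// mul1r.
- rewrite mxfunM; apply: eq_mxfun => x.
  by have [->|x0] := eqVneq x 0; rewrite ?invr0 ?mulr0// mulVf// mul1r.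
- exact: mxfun_hermsym.
- exact: mxfun_hermsym.
Qed.

End Operators.

(* Main.v *)
Require Import Defs.
From HB Require Import structures.
From mathcomp Require Import all_boot all_order all_algebra.
From mathcomp Require Import spectral sesquilinear complex ring lra.
From mathcomp Require Import boolp classical_sets reals constructive_ereal exp.
From mathcomp Require Import topology normedtype derive realfun.

(* Both inequalities are data processing through a measure-and-prepare channel
   A |-> sum_x tr(A M_x) S_x, which is CPTP for every POVM M and densities S_x.
   For the lower bound the channel measures M and records the outcome. For the
   upper bound it prepares S_x from a classical x, with S_x built from the
   eigenvectors e_x and eigenvalues d_x of T^* T, where T = sqrt(rho) times
   sigma^(-1/2): it maps suitable distributions p = d q and q to rho and sigma.
   Then D(p||q) = tr sigma f(T^* T) with f t = t ln t, and the intertwining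
   ln(T T^* ) T = T ln(T^* T) turns this into tr rho ln(T T^* ) = D^R.

   The maximum over measurements is +oo, reached by projecting on the kernel of
   sigma, when the support of rho is not contained in that of sigma. Otherwise
   rho <= c sigma for some c. As D(M(rho)||M(sigma)) is additive over outcomes
   and linear under rescaling of each M_x, a Caratheodory argument replaces M
   by a POVM with n^2 outcomes without decreasing the divergence. These POVMs
   form a compact set on which the divergence is continuous, since p <= c q
   implies |p ln (p/q)| <= (c^2 + 1) q. *)

Set Implicit Arguments.
Unset Strict Implicit.
Unset Printing Implicit Defensive.

Import Order.TTheory GRing.Theory Num.Theory.
Import numFieldNormedType.Exports.
Local Open Scope classical_set_scope.
Local Open Scope ring_scope.
Local Open Scope sesquilinear_scope.

(** * Positive forms and measure-and-prepare maps *)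

Section Positive.
Variable F : numClosedFieldType.

(** At [F := R[i]] this is convertible to [psdmx]; the abstract field keeps rewriting fast. *)
Definition posmx n (A : 'M[F]_n) : Prop :=
  forall u : 'rV[F]_n, 0 <= (u *m A *m u ^t*) 0 0.

Lemma mxadjM m n p (A : 'M[F]_(m, n)) (B : 'M[F]_(n, p)) :
  (A *m B) ^t* = B ^t* *m A ^t*.
Proof. by rewrite trmx_mul map_mxM. Qed.

Lemma mxtrace_mul_adj m n (A : 'M[F]_(m, n)) :
  \tr (A *m A ^t*) = \sum_i \sum_j `|A i j| ^+ 2.
Proof.
apply: eq_bigr => i _; rewrite mxE; apply: eq_bigr => j _.
by rewrite !mxE normCK.
Qed.

Lemma mxtrace_mul_adj_ge0 m n (A : 'M[F]_(m, n)) : 0 <= \tr (A *m A ^t*).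
Proof.
rewrite mxtrace_mul_adj; apply: sumr_ge0 => i _; apply: sumr_ge0 => j _.
by rewrite exprn_ge0.
Qed.

Lemma mxtrace_mul_adj_eq0 m n (A : 'M[F]_(m, n)) :
  \tr (A *m A ^t*) = 0 -> A = 0.
Proof.
rewrite mxtrace_mul_adj => /eqP.
rewrite psumr_eq0 => [/allP A0|i _]; last first.
  by apply: sumr_ge0 => j _; rewrite exprn_ge0.
apply/matrixP => i j; rewrite mxE.
have := A0 i (mem_index_enum i); rewrite psumr_eq0; last first.
  by move=> k _; rewrite exprn_ge0.
move=> /allP/(_ j (mem_index_enum j)) /=.
by rewrite expf_eq0 normr_eq0 => /eqP.
Qed.

Lemma posmx_gram m n (B : 'M[F]_(m, n)) : posmx (B ^t* *m B).
Proof.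
move=> u; rewrite -trace_mx11 mulmxA -mulmxA -{2}(trmxCK B) -mxadjM.
exact: mxtrace_mul_adj_ge0.
Qed.

Lemma mxtrace_gram m n (B : 'M[F]_(m, n)) (A : 'M[F]_n) :
  \tr (A *m (B ^t* *m B)) = \sum_i (row i B *m A *m (row i B) ^t*) 0 0.
Proof.
rewrite mulmxA mxtrace_mulC mulmxA; apply: eq_bigr => i _.
rewrite -row_mul !mxE; apply: eq_bigr => j _; by rewrite !mxE.
Qed.

Lemma mxtrace_gram_ge0 m n (B : 'M[F]_(m, n)) (A : 'M[F]_n) :
  posmx A -> 0 <= \tr (A *m (B ^t* *m B)).
Proof. by move=> A0; rewrite mxtrace_gram; apply: sumr_ge0 => i _. Qed.

Lemma posmx_sum (I : finType) n (A : I -> 'M[F]_n) :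
  (forall i, posmx (A i)) -> posmx (\sum_i A i).
Proof.
move=> A0 u; rewrite mulmx_sumr mulmx_suml summxE.
by apply: sumr_ge0 => i _; exact: A0.
Qed.

Lemma posmxZ n c (A : 'M[F]_n) : 0 <= c -> posmx A -> posmx (c *: A).
Proof.
by move=> c0 A0 u; rewrite -scalemxAr -scalemxAl mxE mulr_ge0// A0.
Qed.

Lemma mxblock_form k n (w : 'I_k -> 'rV[F]_n) (B : 'I_k -> 'I_k -> 'M[F]_n) :
  \mxrow_(i < k) w i *m \mxblock_(i < k, j < k) B i j
    *m (\mxrow_(i < k) w i) ^t*
  = \sum_j \sum_i w i *m B i j *m (w j) ^t*.
Proof.
rewrite mul_mxrow_mxblock.
rewrite (_ : (\mxrow_j w j) ^t* = \mxcol_j ((w j) ^t*)); last first.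
  by apply/matrixP => i j; rewrite !mxE.
by rewrite mul_mxrow_mxcol; apply: eq_bigr => j _; rewrite mulmx_suml.
Qed.

(** An entanglement-breaking channel. Matrix units [delta_mx x x] in place of [S] make it a
    measurement with recorded outcome, in place of [M] the preparation of a classical mixture. *)
Definition measure_prepare k n m (M : 'I_k -> 'M[F]_n) (S : 'I_k -> 'M[F]_m)
    (A : 'M[F]_n) : 'M[F]_m :=
  \sum_x \tr (A *m M x) *: S x.

Lemma measure_prepare_linear k n m (M : 'I_k -> 'M[F]_n) (S : 'I_k -> 'M[F]_m) :
  linear (measure_prepare M S).
Proof.
move=> c A B; rewrite /measure_prepare scaler_sumr -big_split /=.
apply: eq_bigr => x _.
by rewrite mulmxDl mxtraceD -scalemxAl mxtraceZ scalerDl scalerA.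
Qed.

HB.instance Definition _ k n m (M : 'I_k -> 'M[F]_n) (S : 'I_k -> 'M[F]_m) :=
  GRing.isLinear.Build F 'M[F]_n 'M[F]_m _ (measure_prepare M S)
    (measure_prepare_linear M S).

Lemma measure_prepare_trace k n m (M : 'I_k -> 'M[F]_n) (S : 'I_k -> 'M[F]_m) A :
  \sum_x M x = 1%:M -> (forall x, \tr (S x) = 1) ->
  \tr (measure_prepare M S A) = \tr A.
Proof.
move=> M1 S1; rewrite /measure_prepare raddf_sum /=.
under eq_bigr do rewrite mxtraceZ S1 mulr1.
by rewrite -raddf_sum -mulmx_sumr M1 mulmx1.
Qed.

(* With M x = P^* P and S x = Q^* Q, the form of the image block matrix at u
   is the sum over the rows p of P and q of Q of the form of B at the vector
   with blocks <u_i, q> p. *)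
Lemma measure_prepare_pos k n m (M : 'I_k -> 'M[F]_n) (S : 'I_k -> 'M[F]_m)
    (P : 'I_k -> 'M[F]_n) (Q : 'I_k -> 'M[F]_m) :
  (forall x, M x = (P x) ^t* *m P x) -> (forall x, S x = (Q x) ^t* *m Q x) ->
  forall l (B : 'I_l -> 'I_l -> 'M[F]_n),
    posmx (\mxblock_(i < l, j < l) B i j) ->
    posmx (\mxblock_(i < l, j < l) measure_prepare M S (B i j)).
Proof.
move=> MP SQ l B B0 u; rewrite -(submxrowK u) mxblock_form summxE.
pose v j : 'rV[F]_m := submxrow u j.
pose c x b j : F := (v j *m (row b (Q x)) ^t*) 0 0.
pose w x a b j : 'rV[F]_n := c x b j *: row a (P x).
have vQ x j b : (v j *m (Q x) ^t*) 0 b = c x b j.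
  by rewrite /c !mxE; apply: eq_bigr => i _; rewrite !mxE.
pose t x a b i j :=
  c x b i * (row a (P x) *m B i j *m (row a (P x)) ^t*) 0 0 * (c x b j)^*.
have formE x a b : (\mxrow_(i < l) w x a b i *m \mxblock_(i < l, j < l) B i j
    *m (\mxrow_(i < l) w x a b i) ^t*) 0 0 = \sum_j \sum_i t x a b i j.
  rewrite mxblock_form summxE; apply: eq_bigr => j _.
  rewrite summxE; apply: eq_bigr => i _.
  rewrite /w -!scalemxAl linearZ /= map_mxZ -!scalemxAr 2!mxE /t.
  by rewrite mulrA mulrAC.
have : 0 <= \sum_x \sum_a \sum_b \sum_j \sum_i t x a b i j.
  apply: sumr_ge0 => x _; apply: sumr_ge0 => a _; apply: sumr_ge0 => b _.
  rewrite -formE; exact: B0.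
congr (0 <= _).
under eq_bigr do under eq_bigr do rewrite exchange_big /=.
under eq_bigr do rewrite exchange_big /=.
rewrite exchange_big /=; apply: eq_bigr => j _; rewrite summxE.
under eq_bigr do under eq_bigr do rewrite exchange_big /=.
under eq_bigr do rewrite exchange_big /=.
rewrite exchange_big /=; apply: eq_bigr => i _.
rewrite /measure_prepare mulmx_sumr mulmx_suml summxE; apply: eq_bigr => x _.
rewrite MP mxtrace_gram -scalemxAr -scalemxAl mxE mulr_suml.
apply: eq_bigr => a _.
have QvE : Q x *m (v j) ^t* = (v j *m (Q x) ^t*) ^t* by rewrite mxadjM trmxCK.
rewrite -/(v i) -/(v j) SQ (mulmxA (v i)) -(mulmxA _ (Q x)) QvE.
rewrite [X in _ * X]mxE mulr_sumr; apply: eq_bigr => b _.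
rewrite vQ [((v j *m _) ^t*) _ _]mxE [((v j *m _)^T) _ _]mxE vQ.
by rewrite /t; ring.
Qed.

End Positive.

(** * Spectral sums and intertwining under diagonalization *)

Section Conjugation.
Variable F : numClosedFieldType.

Lemma hermsym_adj n (A : 'M[F]_n) : A \is hermsymmx -> A ^t* = A.
Proof. by move=> /is_hermitianmxP {2}->; rewrite expr0 scale1r. Qed.

Lemma mxtrace_mul_delta n (A : 'M[F]_n) x : \tr (A *m delta_mx x x) = A x x.
Proof.
rewrite -(mul_delta_mx (0 : 'I_1)) mulmxA mxtrace_mulC mulmxA -rowE -colE.
by rewrite trace_mx11 !mxE.
Qed.

Lemma unitary_conj_sum n (P : 'M[F]_n) (d : 'rV[F]_n) : P \is unitarymx ->
  invmx P *m diag_mx d *m P = \sum_x d 0 x *: ((row x P) ^t* *m row x P).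
Proof.
move=> Pu; rewrite invmx_unitary//; apply/matrixP => i j.
rewrite mxE summxE; apply: eq_bigr => x _.
by rewrite mul_mx_diag !mxE big_ord1 !mxE mulrAC mulrC mulrA.
Qed.

(* Entrywise in the two eigenbases, [A X = X B] says that an entry of X
   vanishes unless its two eigenvalues agree. *)
Lemma intertwine_diag n m (P : 'M[F]_n) (Q : 'M[F]_m) (d f : 'rV[F]_n)
    (e g : 'rV[F]_m) (X : 'M[F]_(n, m)) : P \in unitmx -> Q \in unitmx ->
  (forall i j, d 0 i = e 0 j -> f 0 i = g 0 j) ->
  (invmx P *m diag_mx d *m P) *m X = X *m (invmx Q *m diag_mx e *m Q) ->
  (invmx P *m diag_mx f *m P) *m X = X *m (invmx Q *m diag_mx g *m Q).
Proof.
move=> Pu Qu fg /(congr1 (fun Z => P *m Z *m invmx Q)).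
rewrite !mulmxA !mulmxV// !mul1mx -!(mulmxA _ Q (invmx Q)) mulmxV// mulmx1 => AX.
have [Y defY] : {Y | Y = P *m X *m invmx Q} by eexists.
have YE : diag_mx d *m Y = Y *m diag_mx e by rewrite defY !mulmxA AX.
have YE' : diag_mx f *m Y = Y *m diag_mx g.
  apply/matrixP => i j; move/matrixP/(_ i j): YE.
  rewrite !mul_diag_mx !mul_mx_diag !mxE.
  have [->|Y0] := eqVneq (Y i j) 0; first by rewrite !(mulr0, mul0r).
  by rewrite ![_ * Y i j]mulrC => /(mulfI Y0)/fg ->.
move: YE' => /(congr1 (fun Z => invmx P *m Z *m Q)).
by rewrite defY !mulmxA mulVmx// mul1mx -!(mulmxA _ (invmx Q) Q) mulVmx// mulmx1.
Qed.

End Conjugation.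

(** * Functional calculus, outcome distributions and channels over [R[i]] *)

Section Psd.
Variable R : realType.
Local Notation C := R[i].

Lemma Re_ger0 (z : C) : 0 <= z -> 0 <= complex.Re z.
Proof. by rewrite lecE => /andP[]. Qed.

Lemma Re_ger0K (z : C) : 0 <= z -> (complex.Re z)%:C%C = z.
Proof. by move=> z0; apply: RRe_real; apply: ger0_real. Qed.

Lemma Re_sum (I : finType) (z : I -> C) :
  complex.Re (\sum_i z i) = \sum_i complex.Re (z i).
Proof. by elim/big_rec2: _ => //= i x y _ <-; case: (z i); case: y. Qed.

Lemma psdmx_adj n (A : 'M[C]_n) : psdmx A -> A ^t* = A.
Proof. by move=> /psdmx_hermsym/hermsym_adj. Qed.

Lemma mxfun_adj n f (A : 'M[C]_n) : (mxfun f A) ^t* = mxfun f A.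
Proof. exact/hermsym_adj/mxfun_hermsym. Qed.

Lemma psdmx_gramP n (A : 'M[C]_n) : psdmx A ->
  A = (sqrtmx A) ^t* *m sqrtmx A.
Proof. by move=> A0; rewrite mxfun_adj sqrtmx_sqr. Qed.

Lemma psdmx_gram m n (B : 'M[C]_(m, n)) : psdmx (B ^t* *m B).
Proof. exact: posmx_gram. Qed.

Lemma psdmx_mul_tr_ge0 n (A B : 'M[C]_n) :
  psdmx A -> psdmx B -> 0 <= \tr (A *m B).
Proof. by move=> A0 /psdmx_gramP ->; exact: mxtrace_gram_ge0. Qed.

Lemma psdmx_tr_ge0 n (A : 'M[C]_n) : psdmx A -> 0 <= \tr A.
Proof.
by move=> /psdmx_gramP ->; rewrite mxtrace_mulC; exact: mxtrace_mul_adj_ge0.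
Qed.

(** Serves for [A = T T^*], [B = T^* T], [X = T], where both products equal [T T^* T]. *)
Lemma mxfun_intertwine n m f (A : 'M[C]_n) (B : 'M[C]_m) (X : 'M[C]_(n, m)) :
  A \is hermsymmx -> B \is hermsymmx -> A *m X = X *m B ->
  mxfun f A *m X = X *m mxfun f B.
Proof.
move=> Ah Bh.
rewrite {1}(orthomx_spectralP (hermitian_normalmx Ah)).
rewrite {1}(orthomx_spectralP (hermitian_normalmx Bh)).
apply: intertwine_diag; try exact: spectral_unit.
by move=> i j; rewrite !mxE => ->.
Qed.

Lemma psdmx_spectral_ge0 n (A : 'M[C]_n) i :
  psdmx A -> 0 <= spectral_diag A 0 i.
Proof.
move=> A0; rewrite spectral_diag_form; first exact: A0.
exact/hermitian_normalmx/psdmx_hermsym.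
Qed.

Lemma eq_mxfun_psd n (f g : R -> R) (A : 'M[C]_n) : psdmx A ->
  (forall x, 0 <= x -> f x = g x) -> mxfun f A = mxfun g A.
Proof.
move=> A0 fg; suff fgE : \row_i (f (complex.Re (spectral_diag A 0 i)))%:C%C =
    \row_i (g (complex.Re (spectral_diag A 0 i)))%:C%C :> 'rV[C]_n.
  by rewrite /mxfun fgE.
by apply/rowP => i; rewrite !mxE fg// Re_ger0// psdmx_spectral_ge0.
Qed.

Lemma mxfun_sum n f (A : 'M[C]_n) : mxfun f A =
  \sum_x (f (complex.Re (spectral_diag A 0 x)))%:C%C
    *: ((row x (spectralmx A)) ^t* *m row x (spectralmx A)).
Proof.
rewrite /mxfun unitary_conj_sum ?spectral_unitarymx//.
by apply: eq_bigr => x _; rewrite mxE.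
Qed.

Lemma mxfun1 n (A : 'M[C]_n) : mxfun (fun=> 1) A = 1%:M.
Proof.
rewrite /mxfun (_ : diag_mx _ = 1%:M) ?mulmx1 ?mulVmx ?spectral_unit//.
by rewrite -diag_const_mx; congr diag_mx; apply/rowP => i; rewrite !mxE.
Qed.

Lemma measure_prepare_cptp k n m (M : 'I_k -> 'M[C]_n) (S : 'I_k -> 'M[C]_m) :
  povm M -> (forall x, density (S x)) -> cptp (measure_prepare M S).
Proof.
move=> [M0 M1] dS; split => [l B|A].
  apply: measure_prepare_pos => x; first exact: psdmx_gramP (M0 x).
  by have [S0 _] := dS x; exact: psdmx_gramP.
by apply: measure_prepare_trace => // x; have [] := dS x.
Qed.

Lemma outcomeE n k (M : 'I_k -> 'M[C]_n) rho x : povm M -> psdmx rho ->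
  (outcome M rho x)%:C%C = \tr (rho *m M x).
Proof. by move=> [M0 _] rho0; rewrite Re_ger0K// psdmx_mul_tr_ge0. Qed.

Lemma outcome_distribution n k (M : 'I_k -> 'M[C]_n) rho :
  povm M -> density rho -> distribution (outcome M rho).
Proof.
move=> [M0 M1] [rho0 rho1]; split=> [x|].
  by rewrite Re_ger0// psdmx_mul_tr_ge0.
by rewrite -Re_sum -raddf_sum /= -mulmx_sumr M1 mulmx1 rho1.
Qed.

Lemma delta_gram k (x : 'I_k) :
  delta_mx x x = (delta_mx ord0 x : 'rV[C]_k) ^t* *m delta_mx 0 x.
Proof.
by rewrite trmx_delta map_delta_mx mul_delta_mx.
Qed.

Lemma density_delta k (x : 'I_k) : density (delta_mx x x : 'M[C]_k).
Proof.
split; first by rewrite delta_gram; exact: psdmx_gram.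
rewrite /mxtrace (bigD1 x)//= mxE eqxx big1 ?addr0// => i ix.
by rewrite mxE (negPf ix).
Qed.

Lemma povm_delta k : povm (fun x : 'I_k => delta_mx x x : 'M[C]_k).
Proof.
split=> [x|]; first by have [] := density_delta x.
by rewrite mx1_sum_delta.
Qed.

Lemma diag_opE k (p : 'I_k -> R) :
  diag_op p = \sum_x (p x)%:C%C *: delta_mx x x.
Proof.
rewrite /diag_op diag_mx_sum_delta; apply: eq_bigr => x _; by rewrite mxE.
Qed.

Lemma measure_diag n k (M : 'I_k -> 'M[C]_n) rho : povm M -> psdmx rho ->
  measure_prepare M (fun x => delta_mx x x) rho = diag_op (outcome M rho).
Proof.
move=> Mp rho0; rewrite diag_opE; apply: eq_bigr => x _; by rewrite outcomeE.
Qed.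

Lemma prepare_diag n k (S : 'I_k -> 'M[C]_n) p :
  measure_prepare (fun x => delta_mx x x) S (diag_op p)
  = \sum_x (p x)%:C%C *: S x.
Proof.
by apply: eq_bigr => x _; rewrite mxtrace_mul_delta !mxE eqxx mulr1n.
Qed.

End Psd.

(** * Algebra of the reverse test *)

Section ReverseTestAlgebra.
Variable F : numClosedFieldType.

(** Read [r] and [s] as the square roots of [rho] and [sigma], [g] as the inverse square root of
    [sigma], and the last hypothesis as the inclusion of supports, [g s] being the projector on the
    support of [sigma]. With [T = r g], the last two conclusions follow from [T s = r]. *)
Lemma reverse_test_algebra n (rho r s g G : 'M[F]_n) :
  r ^t* = r -> s ^t* = s -> g ^t* = g ->
  r *m r = rho -> g *m g = G -> rho *m (g *m s) = rho ->
  exists T : 'M[F]_n,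
  [/\ T *m T ^t* = r *m G *m r, s *m (T ^t* *m T) *m s = rho
    & forall L L', L *m T = T *m L' ->
      s *m (T ^t* *m T *m L') *m s = r *m L *m r].
Proof.
move=> ra sa ga rr gg rhoPi; pose T := r *m g; exists T.
have rPi : r *m (g *m s) = r.
  (* With [K = 1 - g s], the squared norm of [r K] is [tr K^* rho K], which vanishes since
     [rho K = 0]. *)
  suff /eqP : r *m (1%:M - g *m s) = 0.
    by rewrite mulmxBr mulmx1 subr_eq0 => /eqP.
  apply: mxtrace_mul_adj_eq0; rewrite mxtrace_mulC mxadjM ra -mulmxA (mulmxA r r).
  by rewrite rr mulmxBr mulmx1 rhoPi subrr mulmx0 raddf0.
have Ta : T ^t* = g *m r by rewrite mxadjM ga ra.
have Ts : T *m s = r by rewrite -mulmxA.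
have sT : s *m T ^t* = r by rewrite -{1}sa -mxadjM Ts ra.
have TTa : T *m T ^t* = r *m G *m r.
  by rewrite Ta mulmxA -(mulmxA r g g) gg.
clearbody T.
split=> [//||L L' LT].
- by rewrite mulmxA sT -mulmxA Ts.
- by rewrite -(mulmxA _ T L') -LT mulmxA sT -!mulmxA Ts.
Qed.

Lemma sub_ginv n (rho sigma G : 'M[F]_n) : sigma *m G *m sigma = sigma ->
  sigma *m G = G *m sigma -> (rho <= sigma)%MS -> rho *m (sigma *m G) = rho.
Proof. by move=> sGs sG /submxP[Y ->]; rewrite sG -mulmxA (mulmxA sigma) sGs. Qed.

(** With [row x P] the eigenvectors of an operator and [f] a function of its eigenvalues, the sum on
    the right is that function of the operator. *)
Lemma sum_scaled_gram n k (s : 'M[F]_n) (P : 'M[F]_(k, n)) (f q : 'I_k -> F)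
    (S : 'I_k -> 'M[F]_n) : s ^t* = s ->
  (forall x, q x *: S x = (row x P *m s) ^t* *m (row x P *m s)) ->
  \sum_x (f x * q x) *: S x
  = s *m (\sum_x f x *: ((row x P) ^t* *m row x P)) *m s.
Proof.
move=> sa qS; rewrite mulmx_sumr mulmx_suml; apply: eq_bigr => x _.
by rewrite -scalerA qS -scalemxAr -scalemxAl mxadjM sa !mulmxA.
Qed.

(** If the trace vanishes then so does [V], and any [S0] solves the equation; this default lets
    every prepared state be a density even when its weight is 0. *)
Lemma gram_normalize m n (V : 'M[F]_(m, n)) (S0 : 'M[F]_n) :
  exists S : 'M[F]_n, [/\ (\tr (V ^t* *m V)) *: S = V ^t* *m V
    & S = S0 \/ [/\ \tr S = 1 & posmx S]].
Proof.
set q := \tr _.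
have q0 : 0 <= q by rewrite /q mxtrace_mulC mxtrace_mul_adj_ge0.
have [qx0|qn0] := eqVneq q 0.
  exists S0; split; last by left.
  rewrite qx0 scale0r; move: qx0; rewrite /q mxtrace_mulC.
  by move=> /mxtrace_mul_adj_eq0 ->; rewrite mulmx0.
exists (q^-1 *: (V ^t* *m V)); split; first by rewrite scalerA divff// scale1r.
right; split; first by rewrite mxtraceZ mulVf.
by apply: posmxZ; [rewrite invr_ge0 | exact: posmx_gram].
Qed.

End ReverseTestAlgebra.

(** * The reverse test and its divergence *)

Section ReverseTest.
Variable R : realType.
Local Notation C := R[i].

(** One term of the divergence for [p = d q]: [q] cancels in the logarithms, and both sides vanish
    when [d] or [q] is 0. *)
Lemma mulr_ln_eq (d q : R) : 0 <= d -> 0 <= q ->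
  d * q * (ln (d * q) - ln q) = d * ln d * q.
Proof.
rewrite !le_eqVlt => /predU1P[<- _|d0 /predU1P[<-|q0]]; rewrite ?mul0r ?mulr0 ?mul0r//.
by rewrite lnM ?posrE// addrK mulrAC.
Qed.

Lemma ginvmx_comm n (A : 'M[C]_n) : A \is hermsymmx ->
  A *m ginvmx A = ginvmx A *m A.
Proof.
move=> Ah; have AE := mxfun_id Ah.
have AG : A *m ginvmx A = mxfun (fun x => x * x^-1) A by rewrite -mxfunM AE.
have GA : ginvmx A *m A = mxfun (fun x => x^-1 * x) A by rewrite -mxfunM AE.
by apply: etrans AG (etrans _ (esym GA)); apply: eq_mxfun => x; exact: mulrC.
Qed.

Lemma ginvmx_sub n (rho sigma : 'M[C]_n) : sigma \is hermsymmx ->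
  (rho <= sigma)%MS -> rho *m (sigma *m ginvmx sigma) = rho.
Proof.
move=> sh; have [sGs _ _ _] := ginvmx_penrose sh.
exact: sub_ginv sGs (ginvmx_comm sh).
Qed.

(** [g] is the generalized inverse square root: [sqrt x / x] is [1 / sqrt x] for [x > 0] and 0 at 0.
    Hence [g *m sqrtmx A] is the projector on the support. *)
Lemma sqrtginv_sqr n (A : 'M[C]_n) : psdmx A ->
  let g := mxfun (fun x => Num.sqrt x * x^-1) A in
  g *m g = ginvmx A /\ g *m sqrtmx A = A *m ginvmx A.
Proof.
move=> A0 g; split.
  apply: etrans (mxfunM _ _ _) _; apply: eq_mxfun_psd => // x x0.
  have [->|xn0] := eqVneq x 0; first by rewrite invr0 !mulr0.
  by rewrite mulrACA -expr2 sqr_sqrtr// mulrA divff// mul1r.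
have AE := mxfun_id (psdmx_hermsym A0).
have AG : A *m ginvmx A = mxfun (fun x => x * x^-1) A by rewrite -mxfunM AE.
apply: etrans (mxfunM _ _ _) (etrans _ (esym AG)); apply: eq_mxfun_psd => // x x0.
by rewrite mulrAC -expr2 sqr_sqrtr.
Qed.

(* With d = g rho g and g the inverse square root of sigma, e_x the eigenvectors
   and d_x the eigenvalues of d: q x = <e_x|sigma|e_x>, p x = d_x q x, and S x
   is the normalization of the rank-one operator with vector e_x sqrt(sigma). *)
Lemma reverse_test n (rho sigma : 'M[C]_n) :
  density rho -> density sigma -> (rho <= sigma)%MS ->
  exists (p q : 'I_n -> R) (S : 'I_n -> 'M[C]_n),
    [/\ distribution p, distribution q & forall x, density (S x)] /\
    [/\ \sum_x (p x)%:C%C *: S x = rho, \sum_x (q x)%:C%C *: S x = sigma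
      & relent p q = relentR rho sigma].
Proof.
move=> drho [s0 trs] rs; have [r0 trr] := drho.
have [] := sqrtginv_sqr s0.
have := mxfun_adj (fun x => Num.sqrt x * x^-1) sigma.
set g := mxfun _ sigma => ga gg gs.
have := sqrtmx_sqr r0; have := mxfun_adj Num.sqrt rho.
rewrite -/(sqrtmx rho); move rE : (sqrtmx rho) => r ra rr.
have := sqrtmx_sqr s0; have := mxfun_adj Num.sqrt sigma.
rewrite -/(sqrtmx sigma); move: (sqrtmx sigma) gs => s gs sa ss.
have rhoPi : rho *m (g *m s) = rho.
  by rewrite gs; exact: ginvmx_sub (psdmx_hermsym s0) rs.
have [T [TTa sds logT]] := reverse_test_algebra ra sa ga rr gg rhoPi.
have d0 : psdmx (T ^t* *m T) by exact: psdmx_gram.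
have TT0 : psdmx (T *m T ^t*) by have := psdmx_gram (T ^t*); rewrite trmxCK.
have inter : logmx (T *m T ^t*) *m T = T *m logmx (T ^t* *m T).
  by apply: mxfun_intertwine; [exact: psdmx_hermsym.. | rewrite mulmxA].
have logE := logT _ _ inter; rewrite TTa in logE.
move: (T ^t* *m T) d0 sds {inter} logE => d d0 sds logE.
have dh := psdmx_hermsym d0.
have lnE : mxfun (fun x => x * ln x) d = d *m logmx d.
  apply: etrans (esym (mxfunM id (@ln R) d)) _.
  by congr (_ *m _); exact: mxfun_id.
pose dx x : R := complex.Re (spectral_diag d 0 x).
have dx0 x : 0 <= dx x by rewrite Re_ger0// psdmx_spectral_ge0.
pose V x : 'rV[C]_n := row x (spectralmx d) *m s.
pose q x : R := complex.Re (\tr ((V x) ^t* *m V x)).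
have trV0 x : 0 <= \tr ((V x) ^t* *m V x) by exact/psdmx_tr_ge0/psdmx_gram.
have qE x : (q x)%:C%C = \tr ((V x) ^t* *m V x) by exact: Re_ger0K.
have q0 x : 0 <= q x by exact: Re_ger0.
(* [rho] is only a default density, for the case [V x = 0]. *)
have /choice[S HS] x := gram_normalize (V x) rho.
have dS x : density (S x).
  by have [_ [->//|[tS S0]]] := HS x.
have qS x : (q x)%:C%C *: S x = (V x) ^t* *m V x.
  by rewrite qE; have [] := HS x.
(* [f t = t] yields [rho], [f t = 1] yields [sigma], and the trace at [f t = t ln t] yields the
   divergence. *)
have sumS f : \sum_x (f (dx x) * q x)%:C%C *: S x = s *m mxfun f d *m s.
  rewrite mxfun_sum -(sum_scaled_gram _ sa qS).
  by apply: eq_bigr => x _; rewrite rmorphM.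
have sumq f : \sum_x f (dx x) * q x = complex.Re (\tr (s *m mxfun f d *m s)).
  rewrite -sumS [\tr _]raddf_sum Re_sum; apply: eq_bigr => x _ /=.
  by rewrite mxtraceZ; have [_ ->] := dS x; rewrite mulr1.
exists (fun x => dx x * q x), q, S; split; split=> //.
- split=> [x|]; first by rewrite mulr_ge0.
  by rewrite (sumq id) mxfun_id// sds trr.
- split=> //.
  have := sumq (fun=> 1); rewrite mxfun1 mulmx1 ss trs /= => <-.
  by apply: eq_bigr => x _; rewrite mul1r.
- by rewrite (sumS id) mxfun_id.
- have := sumS (fun=> 1); rewrite mxfun1 mulmx1 ss => <-.
  by apply: eq_bigr => x _; rewrite mul1r.
- rewrite /relentR rs /relent ifT; last first.
    by apply/forallP => x; rewrite mulf_eq0 negb_or; apply/implyP => /andP[].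
  congr (_%:E); under eq_bigr do rewrite mulr_ln_eq//.
  (* By [logE] the trace is that of [r L r] with [L] the logarithm of [r G r], [G] the inverse of
     [sigma]; cyclicity and [r r = rho] give [relentR]. *)
  rewrite (sumq (fun x => x * ln x)) lnE logE rE; congr complex.Re.
  by rewrite mxtrace_mulC mulmxA rr.
Qed.

End ReverseTest.

(** * Projection on the kernel *)

Section Kernel.
Variable F : numClosedFieldType.

(** [K = 1 - sigma G] projects on the kernel of [sigma] and [P = sigma G] on its support;
    [rho K = 0] then reads [rho = rho G sigma]. *)
Lemma kernel_projector n (sigma G : 'M[F]_n) :
  sigma *m G *m sigma = sigma -> sigma *m G = G *m sigma ->
  (sigma *m G) ^t* = sigma *m G ->
  exists K P : 'M[F]_n,
    [/\ K ^t* = K, K ^t* *m K = K, P ^t* *m P = P, K + P = 1%:M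
      & sigma *m K = 0] /\ forall rho : 'M_n, rho *m K = 0 -> (rho <= sigma)%MS.
Proof.
move=> sGs sG Pa; pose K := 1%:M - sigma *m G; exists K, (sigma *m G).
have sK : sigma *m K = 0.
  by rewrite /K mulmxBr mulmx1 {1}sG mulmxA sGs subrr.
have PP : (sigma *m G) *m (sigma *m G) = sigma *m G by rewrite mulmxA sGs.
have Ka : K ^t* = K.
  by rewrite /K linearB /= map_mxB Pa trmx1 map_mx1.
have KK : K *m K = K.
  by rewrite {1}/K mulmxBl mul1mx sG -mulmxA sK mulmx0 subr0.
split=> [|rho]; first by rewrite Pa Ka subrK.
rewrite mulmxBr mulmx1 => /eqP; rewrite subr_eq0 => /eqP ->.
by rewrite sG mulmxA submxMl.
Qed.

Lemma mxtrace_gram_eq0 n (r rho K : 'M[F]_n) : r ^t* *m r = rho ->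
  \tr (rho *m (K ^t* *m K)) = 0 -> rho *m K ^t* = 0.
Proof.
move=> <- e; suff /(congr1 (mulmx (r ^t*))) : r *m K ^t* = 0.
  by rewrite mulmxA mulmx0.
apply: mxtrace_mul_adj_eq0; rewrite mxadjM trmxCK mxtrace_mulC -e.
by rewrite [RHS]mxtrace_mulC !mulmxA mxtrace_mulC !mulmxA.
Qed.

Lemma mxtrace_sumZ_mul (I : finType) n (a : I -> F) (S : I -> 'M[F]_n) A :
  \tr ((\sum_x a x *: S x) *m A) = \sum_x a x * \tr (S x *m A).
Proof.
rewrite mulmx_suml [\tr _]raddf_sum /=; apply: eq_bigr => x _.
by rewrite -scalemxAl mxtraceZ.
Qed.

End Kernel.

(** * Infinite divergence and domination of [rho] by [sigma] *)

Section Domination.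
Variable R : realType.
Local Notation C := R[i].

Lemma psdmx_tr_eq0 n (A : 'M[C]_n) : psdmx A -> \tr A = 0 -> A = 0.
Proof.
move=> /psdmx_gramP; move: (sqrtmx A) => B ->.
by rewrite mxtrace_mulC => /mxtrace_mul_adj_eq0 ->; rewrite mulmx0.
Qed.

(** Test for the kernel of [sigma]: that outcome has probability 0 under [sigma], and under [rho]
    only if [rho K = 0], which would give the excluded inclusion of supports. *)
Lemma relent_pinfty n (rho sigma : 'M[C]_n) :
  psdmx rho -> psdmx sigma -> ~~ (rho <= sigma)%MS ->
  exists M : 'I_2 -> 'M[C]_n,
    povm M /\ relent (outcome M rho) (outcome M sigma) = +oo%E.
Proof.
move=> r0 s0 nrs; have sh := psdmx_hermsym s0.
have [sGs _ Ph _] := ginvmx_penrose sh.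
have [K [P [[Ka KK PP KP sK] rhoK]]] :=
  kernel_projector sGs (ginvmx_comm sh) (hermsym_adj Ph).
have K0 : psdmx K by rewrite -KK; exact: psdmx_gram.
have P0 : psdmx P by rewrite -PP; exact: psdmx_gram.
pose M (x : 'I_2) := if x == ord0 then K else P.
have M0 x : psdmx (M x) by rewrite /M; case: eqP.
have M1 : \sum_x M x = 1%:M.
  by rewrite big_ord_recl big_ord1 /M /=.
have Mp : povm M by split.
exists M; split=> //; rewrite /relent ifF//; apply/negbTE/forallPn.
exists ord0; rewrite negb_imply negbK; apply/andP; split.
  apply: contra nrs => /eqP/(congr1 (fun x => x%:C%C)).
  rewrite outcomeE// /M eqxx -{1}KK => tr0; apply: rhoK.
  by have := mxtrace_gram_eq0 (esym (psdmx_gramP r0)) tr0; rewrite Ka.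
by rewrite /outcome /M eqxx sK raddf0.
Qed.

(* The reverse test writes rho and sigma as mixtures of the same densities, so
   the largest likelihood ratio p x / q x, here bounded by their sum, dominates
   rho by sigma (q x = 0 contributes p x / 0 = 0). *)
Lemma density_dominated n (rho sigma : 'M[C]_n) :
  density rho -> density sigma -> (rho <= sigma)%MS ->
  exists2 c : R, 0 <= c & forall A, psdmx A ->
    complex.Re (\tr (rho *m A)) <= c * complex.Re (\tr (sigma *m A)).
Proof.
move=> dr ds rs.
have [p [q [S [[[p0 _] [q0 _] dS] [rE sE pq]]]]] := reverse_test dr ds rs.
(* [relentR] takes its finite branch, so [relent p q] does too: [p] vanishes where [q] does. *)
have {}pq x : q x = 0 -> p x = 0.
  move=> qx0; apply/eqP; move: pq; rewrite /relentR rs /relent.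
  case: ifP => // /forallP/(_ x); rewrite qx0 eqxx /= => h _.
  by move: h; rewrite implybF negbK.
pose c := \sum_x p x / q x.
have c0 x : 0 <= p x / q x by rewrite divr_ge0.
exists c => [|A A0]; first by apply: sumr_ge0 => x _.
rewrite -rE -sE !mxtrace_sumZ_mul !Re_sum mulr_sumr.
apply: ler_sum => x _.
have [S0 _] := dS x.
have /Re_ger0K <- := psdmx_mul_tr_ge0 S0 A0.
rewrite -!rmorphM /= mulrA ler_wpM2r//.
  by rewrite Re_ger0// psdmx_mul_tr_ge0.
have [qx0|qx0] := eqVneq (q x) 0; first by rewrite pq// qx0 mulr0.
rewrite -[leLHS](divfK qx0) ler_wpM2r// /c (bigD1 x)//= lerDl.
exact: sumr_ge0.
Qed.

End Domination.

(** * Linear dependence among POVM elements *)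

Section Dependence.
Variable F : numClosedFieldType.

Lemma mx_dependence N n (M : 'I_N -> 'M[F]_n) : (n * n < N)%N ->
  exists2 v : 'rV[F]_N, v != 0 & \sum_x v 0 x *: M x = 0.
Proof.
move=> nN; pose A : 'M[F]_(N, n * n) := \matrix_x mxvec (M x).
have : kermx A != 0.
  rewrite kermx_eq0 /row_free neq_ltn (leq_ltn_trans (rank_leq_col A))//.
move=> /rowV0Pn[v /sub_kermxP vA v0]; exists v => //.
apply: (can_inj mxvecK); rewrite linear0 -vA mulmx_sum_row linear_sum.
by apply: eq_bigr => x _; rewrite rowK linearZ.
Qed.

(** Adjoints turn the dependence [v] into its conjugate, so the real and imaginary parts of [v] are
    dependences too, and one of them is nonzero. *)
Lemma mx_dependence_real N n (M : 'I_N -> 'M[F]_n) : (n * n < N)%N ->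
  (forall x, (M x) ^t* = M x) ->
  exists2 v : 'rV[F]_N, v != 0 /\ (forall x, v 0 x \is Num.real)
    & \sum_x v 0 x *: M x = 0.
Proof.
move=> nN Ma; have [v v0 vM] := mx_dependence M nN.
have vM' : \sum_x (v 0 x)^* *: M x = 0.
  have := congr1 (fun X : 'M[F]_n => X ^t*) vM.
  rewrite raddf_sum /= map_mx_sum trmx0 map_mx0 => {2}<-.
  by apply: eq_bigr => x _; rewrite linearZ /= map_mxZ Ma.
have [a0|a0] := eqVneq (\row_x 'Re (v 0 x)) 0.
  exists (\row_x 'Im (v 0 x)); first split.
  - apply: contra v0 => /eqP b0; apply/eqP/rowP => x.
    move/rowP/(_ x): a0; move/rowP/(_ x): b0; rewrite !mxE => b0 a0.
    by rewrite [v 0 x]Crect a0 b0 mulr0 addr0.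
  - by move=> x; rewrite mxE Creal_Im.
  - transitivity ('i / 2 *: (\sum_x (v 0 x)^* *: M x - \sum_x v 0 x *: M x)).
      rewrite -sumrB scaler_sumr; apply: eq_bigr => x _.
      rewrite -scalerBl scalerA mxE; congr (_ *: _).
      by rewrite ImE mulrAC.
    by rewrite vM vM' subrr scaler0.
exists (\row_x 'Re (v 0 x)); first split=> //.
- by move=> x; rewrite mxE Creal_Re.
- transitivity (2^-1 *: (\sum_x v 0 x *: M x + \sum_x (v 0 x)^* *: M x)).
    rewrite -big_split scaler_sumr; apply: eq_bigr => x _ /=.
    rewrite -scalerDl scalerA mxE; congr (_ *: _).
    by rewrite ReE mulrC.
  by rewrite vM vM' addr0 scaler0.
Qed.

End Dependence.

(** * Reduction to [n * n] outcomes *)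

Section Reduction.
Variable R : realType.
Local Notation C := R[i].

Lemma psdmxZ m (x : R) (A : 'M[C]_m) : 0 <= x -> psdmx A -> psdmx (x%:C%C *: A).
Proof. by move=> x0 A0; apply: posmxZ A0; rewrite ler0c. Qed.

Definition relterm (p q : R) : R := p * (ln p - ln q).

(** The bound [p <= c * q] excludes [p > 0 = q], where [ln 0 = 0] would break homogeneity. *)
Lemma reltermM (c t p q : R) : 0 <= t -> 0 <= p -> p <= c * q -> 0 <= q ->
  relterm (t * p) (t * q) = t * relterm p q.
Proof.
rewrite /relterm !le_eqVlt => /predU1P[<-|t0]; first by rewrite !mul0r.
move=> /predU1P[<-|p0]; first by rewrite mulr0 !mul0r mulr0.
move=> + /predU1P[q0|q0].
  by rewrite -q0 mulr0 (gt_eqF p0) ltNge (ltW p0).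
by move=> _; rewrite !lnM ?posrE// opprD addrACA subrr add0r mulrA.
Qed.

(** [x0] minimizes [c] and [t = - 1 / c x0], so the weight at [x0] is the first to reach 0. *)
Lemma min_weight N (c : 'I_N.+1 -> R) : (exists y, c y < 0) ->
  exists t x0, [/\ 0 <= t, forall x, 0 <= 1 + t * c x & 1 + t * c x0 = 0].
Proof.
move=> [y cy]; have [x0 _ x0min] := arg_minP c (erefl (xpredT y)).
have cx0 : c x0 < 0 by exact: le_lt_trans (x0min y erefl) cy.
exists (- (c x0)^-1), x0; split.
- by rewrite oppr_ge0 invr_le0 ltW.
- move=> x; rewrite mulNr subr_ge0 mulrC ler_ndivrMr// mul1r; exact: x0min.
- by rewrite mulNr mulVf ?subrr// lt_eqF.
Qed.

Variables (n : nat) (rho sigma : 'M[C]_n) (c : R).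
Hypothesis rho0 : psdmx rho.
Hypothesis sigma0 : psdmx sigma.
Hypothesis rho_le : forall A, psdmx A ->
    complex.Re (\tr (rho *m A)) <= c * complex.Re (\tr (sigma *m A)).

(** The real value of [relent] when [rho] is dominated by [sigma], see [relent_gain]. *)
Definition gain k (M : 'I_k -> 'M[C]_n) : R :=
  \sum_x relterm (outcome M rho x) (outcome M sigma x).

Lemma gain_reweight k (M : 'I_k.+1 -> 'M[C]_n) (w : 'I_k.+1 -> R) x0 :
  povm M -> (forall x, 0 <= w x) -> w x0 = 0 ->
  \sum_x (w x)%:C%C *: M x = 1%:M ->
  exists2 M' : 'I_k -> 'M[C]_n, povm M' &
    gain M' = \sum_x w x * relterm (outcome M rho x) (outcome M sigma x).
Proof.
move=> [M0 M1] w0 wx0 wM.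
pose N y := (w (lift x0 y))%:C%C *: M (lift x0 y); exists N.
  split=> [x|]; first exact: psdmxZ (w0 _) (M0 _).
  by rewrite -wM (bigD1_ord x0)//= wx0 scale0r add0r.
rewrite (bigD1_ord x0)//= wx0 mul0r add0r; apply: eq_bigr => y _.
have outZ tau : psdmx tau ->
    outcome N tau y = w (lift x0 y) * outcome M tau (lift x0 y).
  move=> tau0; rewrite /outcome -scalemxAr mxtraceZ.
  by have /Re_ger0K <- := psdmx_mul_tr_ge0 tau0 (M0 (lift x0 y)); rewrite -rmorphM.
have M0y := M0 (lift x0 y).
have p0 := Re_ger0 (psdmx_mul_tr_ge0 rho0 M0y).
have q0 := Re_ger0 (psdmx_mul_tr_ge0 sigma0 M0y).
by rewrite !outZ//; exact: reltermM (w0 _) p0 (rho_le M0y) q0.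
Qed.

(* The gain is linear under rescaling of the elements of M, so moving along a
   linear dependence in a direction in which it does not decrease, until one
   element vanishes, removes an outcome. *)
Lemma gain_drop k (M : 'I_k.+1 -> 'M[C]_n) : (n * n <= k)%N -> povm M ->
  exists2 M' : 'I_k -> 'M[C]_n, povm M' & gain M <= gain M'.
Proof.
move=> nk Mp; have [M0 M1] := Mp.
pose e x := relterm (outcome M rho x) (outcome M sigma x).
have [v [v0 vr] vM] := mx_dependence_real (M := M) nk (fun x => psdmx_adj (M0 x)).
pose a x : R := complex.Re (v 0 x).
have aE x : (a x)%:C%C = v 0 x by exact: RRe_real.
have aM : \sum_x (a x)%:C%C *: M x = 0.
  by apply: etrans vM; apply: eq_bigr => x _; rewrite aE.
have [z az] : exists z, a z != 0.
  apply/existsP; apply: contraNT v0; rewrite negb_exists => /forallP az.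
  apply/eqP/rowP => x; rewrite mxE -aE.
  by have := az x; rewrite negbK => /eqP ->.
(* Replacing [a] by [- a] if needed makes the gain non-decreasing along [b]. *)
have [b [bM [y by0] be]] : exists b : 'I_k.+1 -> R,
    [/\ \sum_x (b x)%:C%C *: M x = 0, exists y, b y != 0 & 0 <= \sum_x b x * e x].
  have [ae|ae] := leP 0 (\sum_x a x * e x).
    by exists a; split=> //; exists z.
  exists (fun x => - a x); split.
  - transitivity (- \sum_x (a x)%:C%C *: M x); last by rewrite aM oppr0.
    by rewrite -sumrN; apply: eq_bigr => x _; rewrite rmorphN scaleNr.
  - by exists z; rewrite oppr_eq0.
  - under eq_bigr do rewrite mulNr.
    by rewrite sumrN oppr_ge0 ltW.
have [bneg|bpos] := pselect (exists y, b y < 0).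
  have [t [x0 [t0 w0 wx0]]] := min_weight bneg.
  have [|M' M'p gE] := gain_reweight Mp w0 wx0.
    under eq_bigr do rewrite rmorphD rmorph1 rmorphM /= scalerDl scale1r -scalerA.
    by rewrite big_split /= -scaler_sumr bM scaler0 addr0.
  exists M' => //; rewrite gE.
  under [leRHS]eq_bigr do rewrite mulrDl mul1r -mulrA.
  by rewrite big_split /= -mulr_sumr lerDl mulr_ge0.
have b0 x : 0 <= b x.
  by rewrite leNgt; apply/negP => bx; apply: bpos; exists x.
have My : M y = 0.
  apply: (psdmx_tr_eq0 (M0 y)).
  have := congr1 mxtrace bM; rewrite [\tr _]raddf_sum /= mxtrace0.
  under eq_bigr do rewrite mxtraceZ.
  move=> /eqP; rewrite psumr_eq0 => [/allP/(_ y (mem_index_enum y))/=|x _].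
    by rewrite mulf_eq0 (inj_eq (@complexI R)) (negPf by0) => /eqP.
  by apply: mulr_ge0; [rewrite ler0c | exact: psdmx_tr_ge0 (M0 x)].
have ey : e y = 0 by rewrite /e /outcome My !mulmx0 /= raddf0 /relterm mul0r.
have w0 x : 0 <= (x != y)%:R :> R by rewrite ler0n.
have [||M' M'p gE] := gain_reweight (x0 := y) Mp w0.
- by rewrite eqxx.
- rewrite -M1; apply: eq_bigr => x _.
  by case: eqP => [->|_]; rewrite ?My ?scaler0//= scale1r.
- exists M' => //; rewrite gE; apply: ler_sum => x _.
  by case: eqP => [->|_]; rewrite ?mul1r// -/(e y) ey mulr0.
Qed.

(** Zero elements have probability 0 in both states and contribute [relterm 0 0 = 0]. *)
Lemma gain_pad k m (M : 'I_k -> 'M[C]_n) : povm M ->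
  exists2 M' : 'I_(k + m) -> 'M[C]_n, povm M' & gain M <= gain M'.
Proof.
move=> [M0 M1].
exists (fun x => match split x with inl y => M y | inr _ => 0 end).
  split=> [x|].
    by case: split => [y|_ u]; [exact: M0 | rewrite mulmx0 mul0mx mxE].
  rewrite big_split_ord /= [X in _ + X]big1 ?addr0 => [|x _].
    by rewrite -M1; apply: eq_bigr => x _; rewrite (unsplitK (inl x)).
  by rewrite (unsplitK (inr x)).
rewrite /gain big_split_ord /= [X in _ + X]big1 ?addr0 => [|x _].
  by apply: ler_sum => x _; rewrite /outcome (unsplitK (inl x)).
by rewrite /outcome (unsplitK (inr x)) mulmx0 raddf0 /relterm mul0r.
Qed.

Lemma gain_fixed_size k (M : 'I_k -> 'M[C]_n) : povm M ->
  exists2 M' : 'I_(n * n) -> 'M[C]_n, povm M' & gain M <= gain M'.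
Proof.
elim: k M => [|k IH] M Mp.
  by have := gain_pad (n * n) Mp.
(* [M] has [k.+1] outcomes: the second case is [k.+1 <= n * n], where padding suffices. *)
have [nk|nk] := leqP (n * n) k.
  have [M1 M1p le1] := gain_drop nk Mp.
  have [M2 M2p le2] := IH _ M1p; exists M2 => //; exact: le_trans le1 le2.
by have := gain_pad (n * n - k.+1) Mp; rewrite subnKC.
Qed.

End Reduction.

(** * Continuity of the terms of the relative entropy *)

Section RelentContinuity.
Variable R : realType.

(** From [ln y < y], at [y = 1 / sqrt x] for the lower bound and [y = x] for the upper one. The
    right side tends to 0 at 0, hence so does [x ln x]. *)
Lemma xlnx_bound (x : R) : `|x * ln x| <= 2 * Num.sqrt `|x| + x ^+ 2.
Proof.
have [x0|x0] := leP x 0.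
  by rewrite ln0// mulr0 normr0 addr_ge0 ?sqr_ge0// mulr_ge0// sqrtr_ge0.
rewrite (gtr0_norm x0) ler_norml; apply/andP; split.
  have s0 : 0 < Num.sqrt x by rewrite sqrtr_gt0.
  have lns : ln x = 2 * ln (Num.sqrt x).
    by rewrite -{1}(sqr_sqrtr (ltW x0)) expr2 lnM ?posrE// mulr_natl mulr2n.
  have : ln (Num.sqrt x)^-1 < (Num.sqrt x)^-1 by rewrite ln_sublinear ?invr_gt0.
  rewrite lnV ?posrE// => lnb.
  have -> : x * ln x = - (2 * x * - ln (Num.sqrt x)) by rewrite lns; ring.
  rewrite lerN2; apply: (@le_trans _ _ (2 * Num.sqrt x)); last by rewrite lerDl sqr_ge0.
  rewrite -mulrA ler_pM2l//; have := ler_wpM2l (ltW x0) (ltW lnb).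
  have -> // : x * (Num.sqrt x)^-1 = Num.sqrt x.
  by rewrite -{1}(sqr_sqrtr (ltW x0)) expr2 mulfK// gt_eqF.
apply: (@le_trans _ _ (x ^+ 2)); last by rewrite lerDr mulr_ge0// sqrtr_ge0.
by rewrite expr2 ler_wpM2l ?ltW// ln_sublinear.
Qed.

Lemma squeeze_norm (T : Type) (F : set_system T) (f g : T -> R) :
  Filter F -> (forall t, `|f t| <= g t) -> g @ F --> (0 : R) -> f @ F --> (0 : R).
Proof.
move=> FF fg g0; apply: (@squeeze_cvgr _ _ _ _ (fun t => - g t) g) => //.
  by apply: filterE => t; rewrite -ler_norml.
by rewrite -[0]oppr0; exact: cvgN.
Qed.

Lemma continuous_xlnx : continuous (fun x : R => x * ln x).
Proof.
move=> a; have [a0|a0|->] := ltgtP a 0.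
(* Left of 0 the library value of [ln] is 0, so the function is locally constant. *)
- apply: (near_cst_continuous 0); near=> x.
  have x0 : x < 0 by near: x; exact: lt_nbhsl.
  by rewrite ln0 ?mulr0// ltW.
- apply: cvgM; first exact: cvg_id.
  exact: continuous_ln.
- rewrite /continuous_at mul0r.
  apply: (squeeze_norm (g := fun x => 2 * Num.sqrt `|x| + x ^+ 2)).
    exact: xlnx_bound.
  suff : 2 * Num.sqrt `|x| + x ^+ 2 @[x --> (0 : R)]
      --> 2 * Num.sqrt `|0 : R| + 0 ^+ 2.
    by rewrite normr0 sqrtr0 mulr0 expr0n addr0.
  apply: cvgD; last exact: exprn_continuous.
  apply: cvgMl_tmp.
  apply: (continuous_cvg _ (@sqrt_continuous R `|0 : R|)).
  exact: (cvg_norm cvg_id).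
Unshelve. all: by end_near. Qed.

(** From [ln u < u] at [u = p / q] and [u = q / p]: above, [p ^ 2 / q <= c ^ 2 * q]; below,
    [p * (q / p) = q]. *)
Lemma relterm_bound (c p q : R) : 0 <= c -> 0 <= p -> p <= c * q -> 0 <= q ->
  `|relterm p q| <= (c ^+ 2 + 1) * q.
Proof.
move=> c0 p0 pq q0; rewrite /relterm.
have [->|pn0] := eqVneq p 0.
  by rewrite mul0r normr0 mulr_ge0// addr_ge0 ?sqr_ge0.
have {}p0 : 0 < p by rewrite lt0r pn0.
have {}q0 : 0 < q.
  by rewrite lt0r q0 andbT; apply: contraTneq pq => ->; rewrite mulr0 -ltNge.
have up : ln (p / q) <= p / q by rewrite ltW// ln_sublinear// divr_gt0.
have lo : ln (q / p) <= q / p by rewrite ltW// ln_sublinear// divr_gt0.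
rewrite ln_div ?posrE// in up; rewrite ln_div ?posrE// in lo.
rewrite ler_norml; apply/andP; split.
  have : p * (ln q - ln p) <= q.
    by have := ler_wpM2l (ltW p0) lo; rewrite mulrCA divff// mulr1.
  have : 0 <= c ^+ 2 * q by rewrite mulr_ge0 ?sqr_ge0// ltW.
  lra.
apply: (@le_trans _ _ (c ^+ 2 * q)); last by rewrite mulrDl mul1r lerDl ltW.
apply: (le_trans (ler_wpM2l (ltW p0) up)).
rewrite mulrA ler_pdivrMr//.
have -> : c ^+ 2 * q * q = (c * q) ^+ 2 by ring.
by rewrite -expr2 ler_sqr ?nnegrE ?mulr_ge0// ltW.
Qed.

(* Where q vanishes the logarithm is singular, but relterm_bound squeezes the
   term to zero there. *)
Lemma continuous_relterm (T : topologicalType) (c : R) (p q : T -> R) :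
  0 <= c -> (forall t, 0 <= p t) -> (forall t, 0 <= q t) ->
  (forall t, p t <= c * q t) -> continuous p -> continuous q ->
  continuous (fun t => relterm (p t) (q t)).
Proof.
move=> c0 p0 q0 pq cp cq a; have [qa|qa|qa] := ltgtP (q a) 0.
- by move: (q0 a); rewrite leNgt qa.
(* [p a] may be 0, so [p ln p] is treated as one continuous function of [p]. *)
- have -> : (fun t => relterm (p t) (q t)) =
      (fun t => p t * ln (p t) - p t * ln (q t)).
    by apply/funext => t; rewrite /relterm mulrBr.
  rewrite /continuous_at; apply: cvgB.
    apply: (@cvg_comp _ _ _ p (fun x => x * ln x) (nbhs a)); first exact: cp.
    exact: continuous_xlnx.
  apply: cvgM; first exact: cp.
  apply: (@cvg_comp _ _ _ q (@ln R) (nbhs a)); first exact: cq.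
  exact: continuous_ln.
- rewrite /continuous_at.
  have -> : relterm (p a) (q a) = 0.
    apply/eqP; rewrite -normr_le0; apply: le_trans (relterm_bound c0 _ (pq a) _) _ => //.
    by rewrite qa mulr0.
  apply: (squeeze_norm (g := fun t => (c ^+ 2 + 1) * q t)).
    by move=> t; exact: relterm_bound.
  rewrite -(mulr0 (c ^+ 2 + 1)) -qa; apply: cvgMl_tmp.
  exact: cq.
Qed.

End RelentContinuity.

(** * Continuity of complex matrix expressions *)

Section ComplexContinuity.
Variables (R : realType) (T : topologicalType).
Local Notation C := R[i].

(* Continuity for the product topology on C = R x R. *)
Definition ccontinuous (h : T -> C) : Prop :=
  continuous (fun t => complex.Re (h t)) /\
  continuous (fun t => complex.Im (h t)).

Lemma ccontinuous_cst z : ccontinuous (fun=> z).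
Proof. by split => t; exact: cvg_cst. Qed.

Lemma ccontinuousD f g :
  ccontinuous f -> ccontinuous g -> ccontinuous (fun t => f t + g t).
Proof.
move=> [f1 f2] [g1 g2]; split=> t.
  rewrite (_ : (fun t => _) = fun t => complex.Re (f t) + complex.Re (g t)).
    by apply: cvgD; [exact: f1 | exact: g1].
  by apply/funext => u; case: (f u); case: (g u).
rewrite (_ : (fun t => _) = fun t => complex.Im (f t) + complex.Im (g t)).
  by apply: cvgD; [exact: f2 | exact: g2].
by apply/funext => u; case: (f u); case: (g u).
Qed.

Lemma ccontinuousM f g :
  ccontinuous f -> ccontinuous g -> ccontinuous (fun t => f t * g t).
Proof.
move=> [f1 f2] [g1 g2]; split=> t.
  rewrite (_ : (fun t => _) = fun t => complex.Re (f t) * complex.Re (g t)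
      - complex.Im (f t) * complex.Im (g t)).
    by apply: cvgB; apply: cvgM; [exact: f1 | exact: g1 | exact: f2 | exact: g2].
  by apply/funext => u; case: (f u); case: (g u).
rewrite (_ : (fun t => _) = fun t => complex.Re (f t) * complex.Im (g t)
    + complex.Im (f t) * complex.Re (g t)).
  by apply: cvgD; apply: cvgM; [exact: f1 | exact: g2 | exact: f2 | exact: g1].
by apply/funext => u; case: (f u); case: (g u).
Qed.

Lemma ccontinuous_conj f : ccontinuous f -> ccontinuous (fun t => (f t)^*).
Proof.
move=> [f1 f2]; split=> t.
  rewrite (_ : (fun t => _) = fun t => complex.Re (f t)); first exact: f1.
  by apply/funext => u; case: (f u).
rewrite (_ : (fun t => _) = fun t => - complex.Im (f t)).
  by apply: cvgN; exact: f2.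
by apply/funext => u; case: (f u).
Qed.

Lemma ccontinuous_sum (I : finType) (f : I -> T -> C) :
  (forall i, ccontinuous (f i)) -> ccontinuous (fun t => \sum_i f i t).
Proof.
move=> fc; elim: (index_enum I) => [|i r IH].
  by under eq_fun do rewrite big_nil; exact: ccontinuous_cst.
by under eq_fun do rewrite big_cons; exact: ccontinuousD.
Qed.

Definition mxcontinuous m n (A : T -> 'M[C]_(m, n)) : Prop :=
  forall i j, ccontinuous (fun t => A t i j).

Lemma mxcontinuous_cst m n (A : 'M[C]_(m, n)) : mxcontinuous (fun=> A).
Proof. by move=> i j; exact: ccontinuous_cst. Qed.

Lemma mxcontinuousM m n p (A : T -> 'M[C]_(m, n)) (B : T -> 'M[C]_(n, p)) :
  mxcontinuous A -> mxcontinuous B -> mxcontinuous (fun t => A t *m B t).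
Proof.
move=> Ac Bc i j; rewrite (_ : (fun t => _) = fun t => \sum_k A t i k * B t k j).
  by apply: ccontinuous_sum => k; exact: ccontinuousM (Ac i k) (Bc k j).
by apply/funext => t; rewrite mxE.
Qed.

Lemma mxcontinuous_adj m n (A : T -> 'M[C]_(m, n)) :
  mxcontinuous A -> mxcontinuous (fun t => (A t) ^t*).
Proof.
move=> Ac i j; rewrite (_ : (fun t => _) = fun t => (A t j i)^*).
  exact: ccontinuous_conj (Ac j i).
by apply/funext => t; rewrite !mxE.
Qed.

Lemma mxcontinuous_sum (I : finType) m n (A : I -> T -> 'M[C]_(m, n)) :
  (forall k, mxcontinuous (A k)) -> mxcontinuous (fun t => \sum_k A k t).
Proof.
move=> Ac i j; rewrite (_ : (fun t => _) = fun t => \sum_k A k t i j).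
  by apply: ccontinuous_sum => k; exact: Ac.
by apply/funext => t; rewrite summxE.
Qed.

Lemma mxcontinuous_tr n (A : T -> 'M[C]_n) :
  mxcontinuous A -> ccontinuous (fun t => \tr (A t)).
Proof. by move=> Ac; apply: ccontinuous_sum => i; exact: Ac. Qed.

Lemma closed_mx_eq m n (A : T -> 'M[C]_(m, n)) (B : 'M[C]_(m, n)) :
  mxcontinuous A -> closed [set t | A t = B].
Proof.
move=> Ac; rewrite (_ : [set t | _] = \bigcap_(ij in [set: 'I_m * 'I_n])
    ((fun t => complex.Re (A t ij.1 ij.2)) @^-1` [set complex.Re (B ij.1 ij.2)]
     `&` (fun t => complex.Im (A t ij.1 ij.2)) @^-1` [set complex.Im (B ij.1 ij.2)])).
  apply: closed_bigI => -[i j] _ /=; have [c1 c2] := Ac i j.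
  by apply: closedI; apply: preimage_closed;
    [move=> t _; exact: c1 | exact: closed_eq | move=> t _; exact: c2 | exact: closed_eq].
apply/seteqP; split=> [t /= AB ij _|t /= AB]; first by rewrite /= AB.
apply/matrixP => i j; have [] := AB (i, j) I => /=.
by case: (A t i j) => a b; case: (B i j) => c d /= -> ->.
Qed.

End ComplexContinuity.

(** * Compactness of POVMs in Gram coordinates *)

Section Compactness.
Variable R : realType.
Local Notation C := R[i].
Variables (k n : nat).

Local Notation index := ('I_k * 'I_n * 'I_n * bool)%type.

(* The psd matrices are the grams of arbitrary matrices: in the real coordinates
   of the latter, the POVMs become a compact subset of a product of intervals,
   cut out by closed equations only. *)
Definition factors (v : 'rV[R]_#|{: index}|) (x : 'I_k) : 'M[C]_n :=
  \matrix_(i, j) (v 0 (enum_rank (x, i, j, true))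
                  +i* v 0 (enum_rank (x, i, j, false)))%C.

Definition gram_povm (v : 'rV[R]_#|{: index}|) (x : 'I_k) : 'M[C]_n :=
  (factors v x) ^t* *m factors v x.

Lemma psdmx_gram_povm v x : psdmx (gram_povm v x).
Proof. exact: psdmx_gram. Qed.

Lemma gram_povm_surj (M : 'I_k -> 'M[C]_n) : (forall x, psdmx (M x)) ->
  exists v, gram_povm v = M.
Proof.
move=> M0.
pose f (t : index) : R := let: (x, i, j, b) := t in
  let z := sqrtmx (M x) i j in if b then complex.Re z else complex.Im z.
exists (\row_t f (enum_val t)); apply/funext => x.
rewrite [RHS](psdmx_gramP (M0 x)) /gram_povm.
suff -> : factors (\row_t f (enum_val t)) x = sqrtmx (M x) by [].
apply/matrixP => i j; rewrite mxE ![(\row_t _) _ _]mxE !enum_rankK /=.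
by case: (sqrtmx (M x) i j).
Qed.

Lemma continuous_factors x : mxcontinuous (fun v => factors v x).
Proof.
move=> i j; split=> v.
  rewrite (_ : (fun t => _) = fun v : 'rV[R]_#|{: index}| =>
    v 0 (enum_rank (x, i, j, true))).
    exact: coord_continuous.
  by apply/funext => u; rewrite mxE.
rewrite (_ : (fun t => _) = fun v : 'rV[R]_#|{: index}| =>
    v 0 (enum_rank (x, i, j, false))).
  exact: coord_continuous.
by apply/funext => u; rewrite mxE.
Qed.

Lemma continuous_gram_povm x : mxcontinuous (fun v => gram_povm v x).
Proof.
apply: mxcontinuousM; last exact: continuous_factors.
exact/mxcontinuous_adj/continuous_factors.
Qed.

(** Diagonal entry [j] of the constraint says that the squared moduli in column [j] of all factors
    add up to 1, so every coordinate lies in [[-1, 1]]. *)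
Lemma compact_gram_povm : compact [set v | \sum_x gram_povm v x = 1%:M].
Proof.
apply: (@subclosed_compact _ _
    [set v : 'rV[R]_#|{: index}| | forall t, `[(-1 : R), 1]%classic (v ord0 t)]).
- exact/closed_mx_eq/mxcontinuous_sum/continuous_gram_povm.
- by apply: (@rV_compact _ _ (fun=> `[(-1 : R), 1]%classic)) => t; exact: segment_compact.
- move=> v /= sum1 t; rewrite -(enum_valK t).
  case: (enum_val t) => [[[x i] j] b].
  have Ree (z : C) : complex.Re (z^* * z) = complex.Re z ^+ 2 + complex.Im z ^+ 2.
    by case: z => a c /=; rewrite mulNr opprK -!expr2.
  have e1 : \sum_y \sum_l (complex.Re (factors v y l j) ^+ 2
      + complex.Im (factors v y l j) ^+ 2) = 1.
    have := congr1 (fun A : 'M[C]_n => complex.Re (A j j)) sum1.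
    rewrite summxE Re_sum mxE eqxx /= => <-; apply: eq_bigr => y _.
    rewrite mxE Re_sum; apply: eq_bigr => l _.
    by rewrite !mxE Ree.
  have pos y l : 0 <= complex.Re (factors v y l j) ^+ 2
      + complex.Im (factors v y l j) ^+ 2 by rewrite addr_ge0 ?sqr_ge0.
  have : complex.Re (factors v x i j) ^+ 2
      + complex.Im (factors v x i j) ^+ 2 <= 1.
    rewrite -e1 (bigD1 x)//= (bigD1 i)//= -addrA lerDl addr_ge0//.
      exact: sumr_ge0.
    by apply: sumr_ge0 => y _; exact: sumr_ge0.
  rewrite mxE /= in_itv /= -ler_norml.
  set a := v _ _; set c := v _ _ => le1.
  have [sa sc] := (sqr_ge0 a, sqr_ge0 c).
  have [le_a le_c] : `|a| <= 1 /\ `|c| <= 1.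
    by split; rewrite -(@expr_le1 _ 2)// real_normK ?num_real//; lra.
  by case: b.
Qed.

Variables (rho sigma : 'M[C]_n) (c : R).
Hypothesis c0 : 0 <= c.
Hypothesis rho0 : psdmx rho.
Hypothesis sigma0 : psdmx sigma.
Hypothesis rho_le : forall A, psdmx A ->
    complex.Re (\tr (rho *m A)) <= c * complex.Re (\tr (sigma *m A)).

Lemma continuous_gain : continuous (fun v => gain rho sigma (gram_povm v)).
Proof.
have outc tau x : continuous (fun v => outcome (gram_povm v) tau x).
  have := mxcontinuousM (mxcontinuous_cst _ tau) (@continuous_gram_povm x).
  by move=> /mxcontinuous_tr[].
have out0 tau x v : psdmx tau -> 0 <= outcome (gram_povm v) tau x.
  by move=> tau0; exact: Re_ger0 (psdmx_mul_tr_ge0 tau0 (psdmx_gram_povm v x)).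
have termc x : continuous (fun v => relterm (outcome (gram_povm v) rho x)
    (outcome (gram_povm v) sigma x)).
  apply: (@continuous_relterm _ _ c _ _ c0 _ _ _ (outc rho x) (outc sigma x)).
  - by move=> u; exact: out0.
  - by move=> u; exact: out0.
  - by move=> u; exact: rho_le (psdmx_gram_povm u x).
rewrite /gain; elim: (index_enum _) => [|x r IH].
  by under eq_fun do rewrite big_nil; exact: cst_continuous.
under eq_fun do rewrite big_cons.
by move=> v; exact: cvgD (termc x v) (IH v).
Qed.

(** Extreme value theorem on the compact set of Gram coordinates, which [M0] shows to be
    nonempty. *)
Lemma gain_attained (M0 : 'I_k -> 'M[C]_n) : povm M0 ->
  exists2 M : 'I_k -> 'M[C]_n, povm M &
    forall M' : 'I_k -> 'M[C]_n, povm M' -> gain rho sigma M' <= gain rho sigma M.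
Proof.
move=> [M0pos M01]; have [v0 v0E] := gram_povm_surj M0pos.
have [|v /set_mem/= v1 vmax] := compact_EVT_max _ compact_gram_povm
    (continuous_subspaceT continuous_gain).
  by exists v0 => /=; rewrite v0E.
exists (gram_povm v) => [|M' [M'pos M'1]].
  by split=> [x|]; [exact: psdmx_gram_povm | exact: v1].
have [w wE] := gram_povm_surj M'pos.
by rewrite -wE; apply: vmax; apply/mem_set; rewrite /= wE.
Qed.

End Compactness.

(** * Attainment of the measured relative entropy *)

Section MeasuredMaximum.
Variables (R : realType) (n : nat).
Local Notation C := R[i].

(** By domination, an outcome of probability 0 under [sigma] has probability 0 under [rho], so
    [relent] is in its finite branch. *)
Lemma relent_gain k (rho sigma : 'M[C]_n) (M : 'I_k -> 'M[C]_n) (c : R) :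
  psdmx rho ->
  (forall A, psdmx A ->
    complex.Re (\tr (rho *m A)) <= c * complex.Re (\tr (sigma *m A))) ->
  povm M -> relent (outcome M rho) (outcome M sigma) = (gain rho sigma M)%:E.
Proof.
move=> rho0 rho_le [M0 _]; rewrite /relent ifT//.
apply/forallP => x; apply/implyP; apply: contra => /eqP q0.
have p0 : 0 <= outcome M rho x by exact: Re_ger0 (psdmx_mul_tr_ge0 rho0 (M0 x)).
have : outcome M rho x <= c * outcome M sigma x by exact: rho_le (M0 x).
by rewrite q0 mulr0 => ple; rewrite eq_le ple p0.
Qed.

Lemma povm_one : povm (fun _ : 'I_1 => 1%:M : 'M[C]_n).
Proof.
split=> [_|]; last by rewrite big_ord1.
by have := @psdmx_gram R n n 1%:M; rewrite mulmx1 trmx1 map_mx1.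
Qed.

Lemma measured_relent_max (rho sigma : 'M[C]_n) :
  density rho -> density sigma ->
  exists k (M : 'I_k -> 'M[C]_n), povm M /\
    ubound (measured_relents rho sigma)
      (relent (outcome M rho) (outcome M sigma)).
Proof.
move=> dr ds; have [rho0 _] := dr; have [sigma0 _] := ds.
have [sub|nsub] := boolP (rho <= sigma)%MS; last first.
  have [M [Mp ME]] := relent_pinfty rho0 sigma0 nsub.
  by exists 2, M; split=> //; rewrite ME => d _; exact: leey.
have [c c0 rho_le] := density_dominated dr ds sub.
(* The trivial measurement serves to show that POVMs with [n * n] outcomes exist. *)
have [M1 M1p _] := gain_fixed_size rho0 sigma0 rho_le povm_one.
have [M Mp Mmax] := gain_attained c0 rho0 sigma0 rho_le M1p.
exists (n * n)%N, M; split=> // _ [k [N [Np ->]]].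
rewrite (relent_gain rho0 rho_le Mp) (relent_gain rho0 rho_le Np) lee_fin.
have [N' N'p le1] := gain_fixed_size rho0 sigma0 rho_le Np.
exact: le_trans le1 (Mmax _ N'p).
Qed.

Lemma density_diag_op k (p : 'I_k -> R) : distribution p -> density (diag_op p).
Proof.
move=> [p0 p1]; split.
  rewrite diag_opE; apply: posmx_sum => x; apply: psdmxZ => //.
  by have [] := @density_delta R _ x.
rewrite /diag_op mxtrace_diag -[RHS](rmorph1 (real_complex R)) -p1 rmorph_sum.
by apply: eq_bigr => x _; rewrite mxE.
Qed.

End MeasuredMaximum.

(** * Data processing for the two bounds *)

Theorem theorem2p1 (R : realType)
    (DQ : forall n : nat, 'M[R[i]]_n -> 'M[R[i]]_n -> \bar R)
    (DQ_gtNy : forall (n : nat) (rho sigma : 'M[R[i]]_n),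
        density rho -> density sigma -> (-oo < DQ n rho sigma)%E)
    (DQ_monotone : forall (n m : nat)
        (Lambda : {linear 'M[R[i]]_n -> 'M[R[i]]_m}) (rho sigma : 'M[R[i]]_n),
        cptp Lambda -> density rho -> density sigma ->
        (DQ m (Lambda rho) (Lambda sigma) <= DQ n rho sigma)%E)
    (DQ_classical : forall (k : nat) (p q : 'I_k -> R),
        distribution p -> distribution q ->
        DQ k (diag_op p) (diag_op q) = relent p q)
    (n : nat) (rho sigma : 'M[R[i]]_n) :
  density rho -> density sigma ->
  exists DM : \bar R, is_max (measured_relents rho sigma) DM
    /\ (DM <= DQ n rho sigma)%E /\ (DQ n rho sigma <= relentR rho sigma)%E.
Proof.
move=> dr ds; have [r0 _] := dr; have [s0 _] := ds.
have [k [M [Mp Mmax]]] := measured_relent_max dr ds.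
exists (relent (outcome M rho) (outcome M sigma)); split; last split.
- by split=> //; exists k, M.
(* Measure [M] and record the outcome as a diagonal state. *)
- rewrite -DQ_classical; try exact: outcome_distribution.
  rewrite -!measure_diag//; apply: DQ_monotone => //.
  exact: measure_prepare_cptp Mp (@density_delta R k).
- have [sub|nsub] := boolP (rho <= sigma)%MS; last first.
    by rewrite /relentR (negPf nsub) leey.
  have [p [q [S [[dp dq dS] [rE sE <-]]]]] := reverse_test dr ds sub.
  (* Preparing [S x] from [x] maps the diagonal states of [p] and [q] to [rho] and [sigma]. *)
  rewrite -DQ_classical// -{1}rE -{1}sE -!prepare_diag.
  apply: DQ_monotone; [|exact: density_diag_op..].
  exact: measure_prepare_cptp (@povm_delta R n) dS.
Qed.
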